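(* Let $n\ge 2$ be even and let $\mathcal A\subseteq\mathcal K_2$ be a set of convex bodies in $\mathbb R^2$ closed under taking positive linear combinations (i.e. $\lambda K+\mu L\in\mathcal A$ whenever $K,L\in\mathcal A$ and $\lambda,\mu>0$, with Minkowski addition and scaling). Then for every $x\in\mathbb R_{>0}^{\binom{n}{2}}$ we have $x\in\mathcal{PV}(n,\mathcal A)$ if and only if $\varphi(x)\in\varphi(\mathcal{PV}(n,\mathcal A))$.
   Context: $\mathcal K_2$ is the set of non-empty compact convex subsets of $\mathbb R^2$, and $\mathrm V(K,L)$ denotes the mixed volume (mixed area) of $K,L\in\mathcal K_2$. Coordinates of $\mathbb R^{\binom{n}{2}}$ are indexed by the 2-element subsets $I=\{i,j\}\subseteq[n]=\{1,\dots,n\}$. For $K=(K_1,\dots,K_n)\in\mathcal A^n$ let $\mathrm{PV}(K)=(\mathrm V(K_i,K_j))_{\{i,j\}\subseteq[n]}\in\mathbb R^{\binom n2}$, and let the pure mixed volume configuration space be $\mathcal{PV}(n,\mathcal A)=\{\mathrm{PV}(K): K\in\mathcal A^n\}$. The partition monomial map is $\varphi:\mathbb R^{\binom n2}\to\mathbb R^N$, $\varphi(x)=(x_{I_1}x_{I_2}\cdots x_{I_{n/2}})_{I_1|\cdots|I_{n/2}}$, where the index runs over all partitions $I_1|\cdots|I_{n/2}$ of $[n]$ into 2-element subsets and $N$ is the number of such partitions. (Thus $\varphi(\mathcal{PV}(n,\mathcal A))$ is the set of vectors $(\mathrm V_{I_1}(K)\cdots\mathrm V_{I_{n/2}}(K))$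 over $K\in\mathcal A^n$.) *)

(* Defs.v *)
From HB Require Import structures.
From mathcomp Require Import all_boot all_order all_algebra.
From mathcomp Require Import all_classical all_reals all_analysis.
Set Implicit Arguments. Unset Strict Implicit. Unset Printing Implicit Defensive.
Import Order.TTheory GRing.Theory Num.Theory.
Import numFieldNormedType.Exports.
Local Open Scope classical_set_scope.
Local Open Scope ring_scope.

Section ConvexBodies.
Variable R : realType.

Local Notation pt := (R * R)%type.

Definition convex2 (K : set pt) : Prop :=
  forall a b : pt, K a -> K b -> forall t : R, 0 <= t -> t <= 1 ->
    K ((1 - t) * a.1 + t * b.1, (1 - t) * a.2 + t * b.2).

Definition convex_body (K : set pt) : Prop :=
  K !=set0 /\ compact K /\ convex2 K.

Definition msum (K L : set pt) : set pt :=
  [set z | exists2 a, K a & exists2 b, L b & z = (a.1 + b.1, a.2 + b.2)].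
Definition mscale (l : R) (K : set pt) : set pt :=
  [set z | exists2 a, K a & z = (l * a.1, l * a.2)].

Definition area (K : set pt) : R :=
  fine ((@lebesgue_measure R \x @lebesgue_measure R) K)%E.

(* mixed area in the plane: vol(K+L) = vol K + 2 V(K,L) + vol L *)
Definition mixed_area (K L : set pt) : R :=
  (area (msum K L) - area K - area L) / 2.

Definition pos_comb_closed (A : set (set pt)) : Prop :=
  forall K L, A K -> A L -> forall l m : R, 0 < l -> 0 < m ->
    A (msum (mscale l K) (mscale m L)).

(* Vectors in R^{binom n 2}: functions on {set 'I_n}, only the values on
   2-element subsets are meaningful. *)
Definition two_subset n (I : {set 'I_n}) : bool := #|I| == 2%N.

Definition pvcoord n (K : 'I_n -> set pt) (I : {set 'I_n}) : R :=
  match [pick i in I] with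
  | Some i => match [pick j in I :\ i] with
              | Some j => mixed_area (K i) (K j)
              | None => 0
              end
  | None => 0
  end.

Definition vec_eq n (x y : {set 'I_n} -> R) : Prop :=
  forall I, two_subset I -> x I = y I.

Definition PV n (A : set (set pt)) : set ({set 'I_n} -> R) :=
  [set x | exists K : 'I_n -> set pt, (forall i, A (K i)) /\ vec_eq x (pvcoord K)].

Definition pairing n (P : {set {set 'I_n}}) : bool :=
  finset.partition P [set: 'I_n] && [forall I in P, two_subset I].

Definition phi n (x : {set 'I_n} -> R) : {set {set 'I_n}} -> R :=
  fun P => \prod_(I in P) x I.

Definition phivec_eq n (u v : {set {set 'I_n}} -> R) : Prop :=
  forall P, pairing P -> u P = v P.

End ConvexBodies.

(* Main.v *)
Require Import Defs.
From HB Require Import structures.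
From mathcomp Require Import all_boot all_order all_algebra.
From mathcomp Require Import all_classical all_reals all_analysis.
From mathcomp Require Import measurable_realfun ring lra.
Import Order.TTheory GRing.Theory Num.Theory.
Import numFieldNormedType.Exports.
Set Implicit Arguments. Unset Strict Implicit. Unset Printing Implicit Defensive.
Local Open Scope classical_set_scope.
Local Open Scope ring_scope.

(* If [phi x = phi y] with [x, y > 0], exchanging two pairs inside a perfect matching
   shows that the ratios [r_ij = x_ij / y_ij] satisfy [r_ij r_kl = r_ik r_jl], hence
   [r_ij = a_i a_j] for some [a > 0]. If [y] is realized by [K_i], then [x] is
   realized by the dilates [a_i K_i], because the mixed area is bilinear.

   Bilinearity is Minkowski's theorem that the area of [a K + b L] is a quadratic form
   in [a, b > 0]. Choose boundary points [p_k] of [K] and [q_k] of [L] maximizing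
   [y - s_k x] over a fine grid of slopes [s_k]. Then [a p_k + b q_k] maximizes
   [y - s_k x] over [a K + b L], and the trapezoid sum through these points, which is
   exactly quadratic in [a, b], approximates the integral of the upper boundary
   uniformly well: chords and tangents pinch the boundary where the slope is moderate,
   and the steep part projects to a short interval. The lower boundary is the upper
   boundary of the mirror image. *)

(** * Integrals of nearly affine functions and the trapezoid rule *)

Section TrapezoidRule.
Variable R : realType.
Local Notation mu := (@lebesgue_measure R).

Lemma Rintegral_affine (a b u v : R) : u <= v ->
  \int[mu]_(x in `[u, v]) (a + b * x) = (v - u) * ((a + b * u) + (a + b * v)) / 2.
Proof.
rewrite le_eqVlt => /predU1P[->|uv].
  by rewrite set_itv1 Rintegral_set1 subrr !mul0r.
pose F : R -> R := fun x => a * x + b / 2 * x ^+ 2.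
have dF (x : R) : is_derive x 1 F (a + b * x).
  by apply: is_derive_eq; rewrite /GRing.scale /=; field.
have cF (x : R) : {for x, continuous F}.
  apply: differentiable_continuous; apply/derivable1_diffP.
  by have [] := dF x.
rewrite /Rintegral (@continuous_FTC2 _ _ F) //.
- by rewrite -EFinB /= /F; field.
- apply: continuous_subspaceT => x.
  by apply: cvgD; [exact: cvg_cst | apply: cvgM; [exact: cvg_cst|exact: cvg_id]].
- split.
  + by move=> x _; have [] := dF x.
  + by apply: cvg_at_right_filter; exact: cF.
  + by apply: cvg_at_left_filter; exact: cF.
- by move=> x _; rewrite derive1E; apply: derive_val.
Qed.

Variables (f : R -> R) (C : R).
Hypothesis mf : measurable_fun setT f.
Hypothesis fC : forall x, `|f x| <= C.

Lemma bounded_integrable_itv u v : mu.-integrable `[u, v] (EFin \o f).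
Proof.
apply: measurable_bounded_integrable => //.
- rewrite /= lebesgue_measure_itv /=; by case: ifP => _; exact: ltry.
- exact: measurable_funTS.
- exists C; split; first exact: num_real.
  by move=> M CM x _; apply: (le_trans (fC x)); exact: ltW.
Qed.

Lemma Rintegral_itv_cat u v w : u <= v -> v <= w ->
  \int[mu]_(x in `[u, w]) f x =
  \int[mu]_(x in `[u, v]) f x + \int[mu]_(x in `[v, w]) f x.
Proof.
move=> uv vw; have := @Rintegral_itvB R f (BLeft u) (BRight w) v.
move=> /(_ (bounded_integrable_itv _ _)); rewrite !bnd_simp => /(_ uv vw) H.
rewrite -(@Rintegral_itv_obnd_cbnd R v (BRight w)).
  by rewrite -H addrC subrK.
apply: integrableS (bounded_integrable_itv v w) => //.
by apply: subset_itvr; rewrite bnd_simp.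
Qed.

(** [f] is squeezed between the affine functions with constant terms [a - e] and [a + e], for which
    the trapezoid value is exact. *)
Lemma Rintegral_near_affine (a b e u v : R) : u <= v ->
  (forall x, u <= x <= v -> `|f x - (a + b * x)| <= e) ->
  `|\int[mu]_(x in `[u, v]) f x - (v - u) * ((a + b * u) + (a + b * v)) / 2|
    <= e * (v - u).
Proof.
move=> uv fe.
have ia c : mu.-integrable `[u, v] (EFin \o (fun x => c + b * x)).
  apply: continuous_compact_integrable; first exact: segment_compact.
  apply: continuous_subspaceT => x.
  by apply: cvgD; [exact: cvg_cst | apply: cvgM; [exact: cvg_cst|exact: cvg_id]].
have le1 : \int[mu]_(x in `[u, v]) (a - e + b * x) <= \int[mu]_(x in `[u, v]) f x.
  apply: le_Rintegral => //; first exact: bounded_integrable_itv.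
  move=> x; rewrite /= in_itv /= => /fe; rewrite ler_norml; lra.
have le2 : \int[mu]_(x in `[u, v]) f x <= \int[mu]_(x in `[u, v]) (a + e + b * x).
  apply: le_Rintegral => //; first exact: bounded_integrable_itv.
  move=> x; rewrite /= in_itv /= => /fe; rewrite ler_norml; lra.
move: le1 le2; rewrite !Rintegral_affine// ler_norml => le1 le2; lra.
Qed.

Lemma Rintegral_itv_bound (e u v : R) : u <= v ->
  (forall x, u <= x <= v -> `|f x| <= e) ->
  `|\int[mu]_(x in `[u, v]) f x| <= e * (v - u).
Proof.
move=> uv fe; have := @Rintegral_near_affine 0 0 e u v uv.
rewrite !(mul0r, addr0, mulr0, subr0); apply=> x /fe.
by rewrite !(mul0r, addr0, subr0).
Qed.

(** Errors add up over concatenated intervals. The ordering [x 0 <= x m] is carried through the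
    induction because cutting the integral at [x m] requires it. *)
Lemma trapezoid_sum (x y e : nat -> R) (m : nat) :
  (forall k, (k < m)%N -> x k <= x k.+1) ->
  (forall k, (k < m)%N ->
    `|\int[mu]_(t in `[x k, x k.+1]) f t - (x k.+1 - x k) * (y k + y k.+1) / 2|
      <= e k) ->
  x 0%N <= x m /\
  `|\int[mu]_(t in `[x 0%N, x m]) f t
    - \sum_(k < m) (x k.+1 - x k) * (y k + y k.+1) / 2| <= \sum_(k < m) e k.
Proof.
elim: m => [|m IH] xm he.
  by rewrite !big_ord0 set_itv1 Rintegral_set1 subrr normr0.
have [le0 IHm] := IH (fun k km => xm k (ltnW km)) (fun k km => he k (ltnW km)).
have lem := xm m (ltnSn m); split; first exact: le_trans lem.
rewrite (Rintegral_itv_cat le0 lem) !big_ord_recr /=.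
have {}he := he m (ltnSn m).
apply: le_trans (lerD IHm he); apply: le_trans (ler_normD _ _).
by rewrite le_eqVlt; apply/orP; left; apply/eqP; congr `|_|; ring.
Qed.

End TrapezoidRule.

(** * The upper boundary of a convex body and area by vertical slices *)

Section TopBoundary.
Variable R : realType.
Local Notation pt := (R * R)%type.
Local Notation mu := (@lebesgue_measure R).
Implicit Types (M K L : set pt) (p q z : pt).

(* [top M x] is [0] when the slice of [M] over [x] is empty. *)
Definition top M (x : R) : R := sup [set y | M (x, y)].

Definition in_box (C : R) M := forall z, M z -> `|z.1| <= C /\ `|z.2| <= C.

Definition flip M : set pt := [set z | M (z.1, - z.2)].

(** The line of slope [s] through [p] supports [M] from above. Indexing by slope instead of normal
    direction leaves out vertical support lines. *)
Definition maximizes (s : R) M p :=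
  M p /\ forall z, M z -> z.2 - s * z.1 <= p.2 - s * p.1.

Lemma top_out M x : (forall y, ~ M (x, y)) -> top M x = 0.
Proof.
move=> H; rewrite /top (_ : [set y | _] = set0) ?sup0 //.
by apply/seteqP; split=> // y /H.
Qed.

Lemma top_ub M C x y : in_box C M -> M (x, y) -> y <= top M x.
Proof.
move=> bM Mxy; apply: ub_le_sup => //; exists C => w /bM[_] /=.
exact: le_trans (ler_norm _).
Qed.

Lemma top_le M x y c : M (x, y) -> (forall w, M (x, w) -> w <= c) -> top M x <= c.
Proof. by move=> Mxy H; apply: ge_sup; [exists y | move=> w /H]. Qed.

Lemma top_bound M C x : 0 <= C -> in_box C M -> `|top M x| <= C.
Proof.
move=> C0 bM; have [[y Mxy]|H] := pselect (exists y, M (x, y)).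
  rewrite ler_norml; apply/andP; split.
    apply: le_trans (top_ub bM Mxy); have [_] := bM _ Mxy.
    by rewrite ler_norml => /andP[].
  apply: top_le Mxy _ => w /bM[_]; exact: le_trans (ler_norm _).
by rewrite top_out ?normr0 // => y Mxy; apply: H; exists y.
Qed.

Lemma continuous_slope (s : R) : continuous (fun z : pt => z.2 - s * z.1).
Proof.
move=> z; apply: cvgB; first exact: cvg_snd.
by apply: cvgM; [exact: cvg_cst | exact: cvg_fst].
Qed.

Lemma ex_maximizes M s : convex_body M -> exists p, maximizes s M p.
Proof.
move=> [M0 [cM _]].
have [|p pM pmax] := compact_EVT_max (f := fun z : pt => z.2 - s * z.1) M0 cM.
  by apply: continuous_subspaceT; exact: continuous_slope.
exists p; split; first exact/set_mem.
by move=> z zM; apply: pmax; exact/mem_set.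
Qed.

Lemma top_mem M C x y : convex_body M -> in_box C M -> M (x, y) -> M (x, top M x).
Proof.
move=> [M0 [cM _]] bM Mxy.
have cS : compact (M `&` [set z | z.1 = x]).
  apply: compact_closedI => //.
  have := @closed_comp _ _ (fst : pt -> R) [set x].
  by apply; [move=> z _; exact: cvg_fst | exact: closed_eq].
have [||[x' y'] /set_mem[/= Mp px] pmax] :=
    compact_EVT_max (f := fun z : pt => z.2) _ cS.
- by exists (x, y).
- by apply: continuous_subspaceT => z; exact: cvg_snd.
subst x'; rewrite (_ : top M x = y') //; apply/eqP; rewrite eq_le (top_ub bM) // andbT.
apply: top_le Mp _ => w Mxw; apply: (pmax (x, w)); exact/mem_set.
Qed.

(** The abscissae of the points of [M] at height at least [c] form an interval, by convexity. This
    is the superlevel set of [top M], up to the abscissae with empty slice, which the default value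
    [0] adds exactly when [c <= 0]. *)
Lemma measurable_top M C : convex_body M -> in_box C M -> measurable_fun setT (top M).
Proof.
move=> cM bM.
have mP c : measurable [set x | exists2 y, M (x, y) & c <= y].
  apply: is_interval_measurable => x1 x2 [y1 M1 c1] [y2 M2 c2] x /andP[x1x xx2].
  have [x12|x12] := ltP x1 x2; last first.
    have -> : x = x1 by lra.
    by exists y1.
  pose t := (x - x1) / (x2 - x1).
  have t0 : 0 <= t by rewrite divr_ge0 //; lra.
  have t1 : t <= 1 by rewrite ler_pdivrMr; lra.
  have [_ [_ cvM]] := cM; have := cvM _ _ M1 M2 t t0 t1.
  rewrite /= (_ : _ * x1 + _ = x) => [Mx|]; last first.
    by rewrite /t; field; rewrite subr_eq0 gt_eqF.
  by exists ((1 - t) * y1 + t * y2) => //; nra.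
have mD : measurable [set x | exists y, M (x, y)].
  rewrite (_ : mkset _ = [set x | exists2 y, M (x, y) & - C <= y]) //.
  apply/seteqP; split=> x [y Mxy]; last by exists y.
  by exists y => //; have [_] := bM _ Mxy; rewrite /= ler_norml => /andP[].
apply: (measurability _ (RGenCInfty.measurableE R)) => _ [_ [c ->] <-].
rewrite setTI (_ : _ @^-1` _ = [set x | exists2 y, M (x, y) & c <= y] `|`
   (~` [set x | exists y, M (x, y)] `&` [set _ | c <= 0])).
  apply: measurableU => //; apply: measurableI; first exact: measurableC.
  case: (leP c 0) => _; first by rewrite (_ : mkset _ = setT) //; apply/seteqP; split.
  by rewrite (_ : mkset _ = set0) //; apply/seteqP; split.
apply/seteqP; split=> x; rewrite /= in_itv /= andbT.
  move=> ct; have [[y Mxy]|nM] := pselect (exists y, M (x, y)).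
    by left; exists (top M x) => //; exact: (top_mem cM bM Mxy).
  right; split=> //; move: ct; rewrite top_out // => y Mxy.
  by apply: nM; exists y.
move=> [[y Mxy cy]|[nM c0]]; first exact: le_trans (top_ub bM Mxy).
by rewrite top_out // => y Mxy; apply: nM; exists y.
Qed.

Lemma convex_body_flip M : convex_body M -> convex_body (flip M).
Proof.
move=> [[[a b] Mab] [cM vM]]; split; first by exists (a, - b); rewrite /flip /= opprK.
split.
  rewrite (_ : flip M = (fun z : pt => (z.1, - z.2)) @` M).
    apply: continuous_compact => //; apply: continuous_subspaceT => z.
    have c2 : - (z0.2) @[z0 --> z] --> - z.2 by apply: cvgN; exact: cvg_snd.
    exact: (cvg_pair (F := nbhs z) (cvg_fst (F := nbhs z.1) (G := nbhs z.2)) c2).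
  apply/seteqP; split=> [[x y] /= Mz|_ [[x y] /= Mz <-]].
    by exists (x, - y) => //=; rewrite opprK.
  by rewrite /flip /= opprK.
move=> z w Mz Mw t t0 t1; rewrite /flip /=.
have := vM _ _ Mz Mw t t0 t1; rewrite /= (_ : _ * - z.2 + _ = - ((1 - t) * z.2 + t * w.2)) //.
by ring.
Qed.

Lemma in_box_flip C M : in_box C M -> in_box C (flip M).
Proof. by move=> bM z /bM; rewrite /= normrN. Qed.

(** A nonempty slice is the segment from [- top (flip M) x] to [top M x]; over an empty slice both
    default values are [0], the measure of the empty set. *)
Lemma slice_measure M C x : convex_body M -> in_box C M ->
  mu (xsection M x) = (top M x + top (flip M) x)%:E.
Proof.
move=> cM bM; have cN := convex_body_flip cM; have bN := in_box_flip bM.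
have [[y Mxy]|nM] := pselect (exists y, M (x, y)); last first.
  have H y : ~ M (x, y) by move=> Mxy; apply: nM; exists y.
  rewrite !top_out ?addr0 // => [|y]; last exact: H.
  rewrite (_ : xsection M x = set0) ?measure0 //.
  by apply/seteqP; split=> y //; rewrite /xsection /= => /set_mem /H.
have Nxy : flip M (x, - y) by rewrite /flip /= opprK.
have T1 := top_mem cM bM Mxy.
have T2 : M (x, - top (flip M) x) := top_mem cN bN Nxy.
have le12 := top_ub bM T2.
rewrite (_ : xsection M x = `[- top (flip M) x, top M x]%classic).
  rewrite lebesgue_measure_itv /= lte_fin; case: ltP => [_|le21].
    by rewrite -EFinB opprK.
  by congr EFin; lra.
apply/seteqP; split=> w; rewrite /xsection /= in_itv /=.
  move=> /set_mem Mw; rewrite (top_ub bM) // andbT lerNl (top_ub bN) //.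
  by rewrite /flip /= opprK.
move=> /andP[w1 w2]; apply/mem_set.
move: le12 => /[dup] le12; rewrite le_eqVlt => /predU1P[E|lt12].
  by have -> : w = top M x by lra.
set a := - _ in lt12 w1 T2; set b := top M x in lt12 w2 T1.
pose t := (w - a) / (b - a).
have t0 : 0 <= t by rewrite divr_ge0 //; lra.
have t1 : t <= 1 by rewrite ler_pdivrMr; lra.
have [_ [_ cvM]] := cM; have := cvM _ _ T2 T1 t t0 t1.
rewrite /= (_ : _ * x + _ = x); last by ring.
rewrite (_ : _ * a + _ = w) // /t; field; by rewrite subr_eq0 gt_eqF.
Qed.

Definition top_area C M : R := \int[mu]_(x in `[- C, C]) top M x.

Lemma area_top M C : 0 <= C -> convex_body M -> in_box C M ->
  area M = top_area C M + top_area C (flip M).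
Proof.
move=> C0 cM bM; have cN := convex_body_flip cM; have bN := in_box_flip bM.
have iM := bounded_integrable_itv (measurable_top cM bM)
  (fun x => top_bound x C0 bM) (- C) C.
have iN := bounded_integrable_itv (measurable_top cN bN)
  (fun x => top_bound x C0 bN) (- C) C.
rewrite /area /product_measure1 /top_area -RintegralD //.
rewrite /Rintegral [in RHS]integral_mkcond; congr fine.
apply: eq_integral => x _; rewrite /= (slice_measure x cM bM) patchE.
(* Outside [[- C, C]] all slices are empty, so the integral over the line reduces to the box. *)
case: ifPn => // /negP xC; rewrite !top_out ?addr0 // => y.
  rewrite /flip /= => /bM[/= + _]; rewrite ler_norml => Cx.
  by apply: xC; apply/mem_set; rewrite /= in_itv.
move=> /bM[/= + _]; rewrite ler_norml => Cx.
by apply: xC; apply/mem_set; rewrite /= in_itv.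
Qed.

End TopBoundary.

(** * Approximating the area under the upper boundary by touching points *)

Section Approximation.
Variable R : realType.
Local Notation pt := (R * R)%type.
Local Notation mu := (@lebesgue_measure R).
Implicit Types (M K L : set pt) (p q : nat -> pt).

(** A decreasing grid of mesh [1 / N], from [N] at [k = 0] to [- N] at [k = 2 * N * N]: large [N]
    gives both a fine mesh and steep ends. *)
Definition slope (N k : nat) : R := N%:R - k%:R / N%:R.

(** The signed area under the polygonal line through [p 0, ..., p m]. *)
Definition trapezoids (m : nat) p : R :=
  \sum_(k < m) ((p k.+1).1 - (p k).1) * ((p k).2 + (p k.+1).2) / 2.

(** Testing each maximum at the other point and adding gives [(s - s') * (a.1 - b.1) <= 0]. *)
Lemma maximizes_mono s s' M (a b : pt) : s' < s ->
  maximizes s M a -> maximizes s' M b -> a.1 <= b.1.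
Proof. by move=> ss [Ma /= Ha] [Mb Hb]; have := Ha _ Mb; have := Hb _ Ma; nra. Qed.

(* Between two consecutive touching points the boundary lies above the chord and
   below both tangents. *)
Lemma top_near_chord M C s s' (a b : pt) (x d : R) : convex_body M -> in_box C M ->
  maximizes s M a -> maximizes s' M b -> s' < s -> a.1 < b.1 -> a.1 <= x <= b.1 ->
  d * (b.1 - a.1) = b.2 - a.2 ->
  `|top M x - (a.2 - d * a.1 + d * x)| <= (s - s') * (b.1 - a.1).
Proof.
move=> cM bM [Ma Ha] [Mb Hb] ss ab /andP[ax xb] dE.
have Mc : M (x, a.2 - d * a.1 + d * x).
  pose t := (x - a.1) / (b.1 - a.1).
  have t0 : 0 <= t by rewrite divr_ge0 //; lra.
  have t1 : t <= 1 by rewrite ler_pdivrMr; lra.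
  have [_ [_ vM]] := cM; have := vM _ _ Ma Mb t t0 t1.
  have tE : t * (b.1 - a.1) = x - a.1 by rewrite divfK // subr_eq0 gt_eqF.
  have -> : (1 - t) * a.1 + t * b.1 = x by lra.
  have -> // : (1 - t) * a.2 + t * b.2 = a.2 - d * a.1 + d * x.
  have -> : (1 - t) * a.2 + t * b.2 = a.2 + t * (b.2 - a.2) by ring.
  have -> : a.2 - d * a.1 + d * x = a.2 + d * (x - a.1) by ring.
  by rewrite -dE -tE; ring.
have lo := top_ub bM Mc.
have up : top M x <= a.2 + s * (x - a.1).
  by apply: top_le Mc _ => w /Ha /=; lra.
(* The tangent at [a] exceeds the chord by [(s - d) * (x - a.1)]. Maximality of [b], tested at [a],
   bounds the chord slope [d] below by [s']. *)
have s'd : s' <= d.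
  have ab0 : 0 < b.1 - a.1 by lra.
  by rewrite -(ler_pM2r ab0) dE; have := Hb _ Ma; lra.
rewrite ger0_norm; last by lra.
nra.
Qed.

Lemma top_area_approx M C N p : 0 < C -> convex_body M -> in_box C M ->
  (0 < N)%N ->
  (forall k, (k <= 2 * N * N)%N -> maximizes (slope N k) M (p k)) ->
  `|top_area C M - trapezoids (2 * N * N) p| <= 10 * C ^+ 2 / N%:R.
Proof.
move=> C0 cM bM N0 pM; set m := (2 * N * N)%N in pM *.
have mf := measurable_top cM bM.
have fC x := top_bound x (ltW C0) bM.
have NR : 0 < N%:R :> R by rewrite ltr0n.
pose h : R := N%:R^-1.
have h0 : 0 < h by rewrite invr_gt0.
have hN : h * N%:R = 1 by rewrite mulVf // gt_eqF.
have slopeS k : slope N k - slope N k.+1 = h.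
  by rewrite /slope /h -(natr1 k); field; rewrite gt_eqF.
have slope0 : slope N 0 = N%:R by rewrite /slope mul0r subr0.
have slopem : slope N m = - N%:R.
  by rewrite /slope /m !natrM; field; rewrite gt_eqF.
have pB k : (k <= m)%N -> [/\ - C <= (p k).1, (p k).1 <= C, - C <= (p k).2 & (p k).2 <= C].
  by move=> /pM[/bM[]]; rewrite !ler_norml => /andP[-> ->] /andP[-> ->].
have step k : (k < m)%N -> (p k).1 <= (p k.+1).1.
  move=> km; apply: (maximizes_mono _ (pM k (ltnW km)) (pM k.+1 km)).
  by have := slopeS k; lra.
(* The chord error on one step is [h] times the squared width; bounding one width by [2 * C] makes
   the errors telescope. *)
have [|le0m mid] := @trapezoid_sum R (top M) C mf fC (fun k => (p k).1)
    (fun k => (p k).2) (fun k => 2 * C * h * ((p k.+1).1 - (p k).1)) m step.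
  move=> k km; have := step k km; rewrite le_eqVlt => /predU1P[E|lt].
    by rewrite -E set_itv1 Rintegral_set1 subrr !(mul0r, mulr0) subrr normr0.
  have ss : slope N k.+1 < slope N k by have := slopeS k; lra.
  pose d := ((p k.+1).2 - (p k).2) / ((p k.+1).1 - (p k).1).
  have dE : d * ((p k.+1).1 - (p k).1) = (p k.+1).2 - (p k).2.
    by rewrite divfK // subr_eq0 gt_eqF.
  have := @Rintegral_near_affine R (top M) C mf fC ((p k).2 - d * (p k).1) d
    (h * ((p k.+1).1 - (p k).1)) _ _ (ltW lt).
  have -> : (p k).2 - d * (p k).1 + d * (p k).1 = (p k).2 by ring.
  have -> : (p k).2 - d * (p k).1 + d * (p k.+1).1 = (p k.+1).2.
    by rewrite -(subrK (p k).2 (p k.+1).2) -dE; ring.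
  move=> near; apply: le_trans (near _) _.
    move=> x xk; rewrite -(slopeS k).
    exact: (top_near_chord cM bM (pM k (ltnW km)) (pM k.+1 km) ss lt xk dE).
  apply: ler_wpM2r; first by rewrite subr_ge0 ltW.
  have [? _ _ _] := pB k (ltnW km); have [_ ? _ _] := pB k.+1 km.
  by rewrite mulrC ler_wpM2r //; lra.
have [x0l x0u y0l y0u] := pB 0%N (leq0n m).
have [xml xmu yml ymu] := pB m (leqnn m).
have [_ P0] := pM 0%N (leq0n m); have [_ Pm] := pM m (leqnn m).
rewrite slope0 in P0; rewrite slopem in Pm.
have left_end : `|\int[mu]_(x in `[- C, (p 0%N).1]) top M x| <= 3 * C ^+ 2 * h.
  (* A point of [M] over [x] satisfies [N * ((p 0).1 - x) <= 2 * C], by maximality at slope [N]. The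
     factor [3] makes the contradiction strict, so slices left of [w] are empty. *)
  pose w := (p 0%N).1 - 3 * C * h.
  have out x : x <= w -> top M x = 0.
    move=> xw; apply: top_out => y Mxy; have := P0 _ Mxy.
    have [_] := bM _ Mxy; rewrite /= ler_norml => /andP[yl yu] H.
    have : 3 * C * h * N%:R <= ((p 0%N).1 - x) * N%:R.
      by apply: ler_wpM2r; [exact: ltW | rewrite /w in xw; lra].
    by rewrite -mulrA hN; lra.
  have [wC|Cw] := leP w (- C).
    apply: le_trans (Rintegral_itv_bound mf fC x0l (fun x _ => fC x)) _.
    have : (p 0%N).1 - - C <= 3 * C * h by rewrite /w in wC; lra.
    by move=> /(ler_wpM2l (ltW C0)); rewrite expr2; lra.
  have w0 : w <= (p 0%N).1 by rewrite /w; nra.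
  rewrite (Rintegral_itv_cat mf fC (ltW Cw) w0).
  have := @Rintegral_itv_bound _ _ _ mf fC 0 _ _ (ltW Cw).
  have f0 x : - C <= x <= w -> `|top M x| <= 0.
    by move=> /andP[_ /out ->]; rewrite normr0.
  move=> /(_ f0); rewrite mul0r normr_le0 => /eqP ->; rewrite add0r.
  apply: le_trans (Rintegral_itv_bound mf fC w0 (fun x _ => fC x)) _.
  by rewrite /w expr2; lra.
have right_end : `|\int[mu]_(x in `[(p m).1, C]) top M x| <= 3 * C ^+ 2 * h.
  pose w := (p m).1 + 3 * C * h.
  have out x : w <= x -> top M x = 0.
    move=> xw; apply: top_out => y Mxy; have := Pm _ Mxy.
    have [_] := bM _ Mxy; rewrite /= ler_norml => /andP[yl yu] H.
    have : 3 * C * h * N%:R <= (x - (p m).1) * N%:R.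
      by apply: ler_wpM2r; [exact: ltW | rewrite /w in xw; lra].
    by rewrite -mulrA hN; lra.
  have [wC|Cw] := leP C w.
    apply: le_trans (Rintegral_itv_bound mf fC xmu (fun x _ => fC x)) _.
    have : C - (p m).1 <= 3 * C * h by rewrite /w in wC; lra.
    by move=> /(ler_wpM2l (ltW C0)); rewrite expr2; lra.
  have w0 : (p m).1 <= w by rewrite /w; nra.
  rewrite (Rintegral_itv_cat mf fC w0 (ltW Cw)).
  have := @Rintegral_itv_bound _ _ _ mf fC 0 _ _ (ltW Cw).
  have f0 x : w <= x <= C -> `|top M x| <= 0.
    by move=> /andP[/out -> _]; rewrite normr0.
  move=> /(_ f0); rewrite mul0r normr_le0 => /eqP ->; rewrite addr0.
  apply: le_trans (Rintegral_itv_bound mf fC w0 (fun x _ => fC x)) _.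
  by rewrite /w expr2; lra.
have midE : \sum_(k < m) 2 * C * h * ((p k.+1).1 - (p k).1) <= 4 * C ^+ 2 * h.
  rewrite -mulr_sumr -(big_mkord xpredT (fun k => (p k.+1).1 - (p k).1)).
  rewrite telescope_sumr // expr2.
  have : (p m).1 - (p 0%N).1 <= 2 * C by lra.
  have Ch : 0 <= 2 * C * h by nra.
  by move=> /(ler_wpM2l Ch); lra.
rewrite /top_area (Rintegral_itv_cat mf fC x0l (le_trans le0m xmu)).
rewrite (Rintegral_itv_cat mf fC le0m xmu) -/h.
move: mid left_end right_end midE; rewrite -/(trapezoids m p) !ler_norml.
lra.
Qed.

End Approximation.

Local Notation mscale := Defs.mscale.
Local Notation msum := Defs.msum.

(** * Minkowski combinations and the quadratic area form *)

Section MinkowskiCombination.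
Variable R : realType.
Local Notation pt := (R * R)%type.
Implicit Types (M K L : set pt) (a b s C : R).

Definition comb a b K L : set pt := msum (mscale a K) (mscale b L).

Definition pcomb a b (p q : pt) : pt := (a * p.1 + b * q.1, a * p.2 + b * q.2).

Lemma combP a b K L z :
  comb a b K L z <-> exists2 p, K p & exists2 q, L q & z = pcomb a b p q.
Proof.
split=> [[_ [p Kp ->] [_ [q Lq ->] ->]]|[p Kp [q Lq ->]]].
  by exists p => //; exists q.
by exists (a * p.1, a * p.2); [exists p|exists (b * q.1, b * q.2) => //; exists q].
Qed.

Lemma mscale1 K : mscale 1 K = K.
Proof.
apply/seteqP; split=> [_ [[x y] Kz ->]|[x y] Kz]; first by rewrite /= !mul1r.
by exists (x, y) => //=; rewrite !mul1r.
Qed.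

Lemma msum_comb K L : msum K L = comb 1 1 K L.
Proof. by rewrite /comb !mscale1. Qed.

Lemma convex_body_comb a b K L :
  convex_body K -> convex_body L -> convex_body (comb a b K L).
Proof.
move=> [[p Kp] [cK vK]] [[q Lq] [cL vL]]; split.
  by exists (pcomb a b p q); apply/combP; exists p => //; exists q.
split.
  rewrite (_ : comb a b K L = (fun w : pt * pt => pcomb a b w.1 w.2) @` (K `*` L)).
    apply: continuous_compact; last exact: compact_setX.
    apply: continuous_subspaceT => w.
    have c1 : z.1 @[z --> w] --> w.1 by exact: cvg_fst.
    have c2 : z.2 @[z --> w] --> w.2 by exact: cvg_snd.
    have d1 (u : pt) : z.1 @[z --> u] --> u.1 by exact: cvg_fst.
    have d2 (u : pt) : z.2 @[z --> u] --> u.2 by exact: cvg_snd.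
    have lin (f g : pt * pt -> R) (u v : R) :
        f z @[z --> w] --> u -> g z @[z --> w] --> v ->
        a * f z + b * g z @[z --> w] --> a * u + b * v.
      by move=> cf cg; apply: cvgD; apply: cvgM => //; exact: cvg_cst.
    have e1 := lin (fun z => z.1.1) (fun z => z.2.1) _ _
      (cvg_comp _ _ c1 (d1 _)) (cvg_comp _ _ c2 (d1 _)).
    have e2 := lin (fun z => z.1.2) (fun z => z.2.2) _ _
      (cvg_comp _ _ c1 (d2 _)) (cvg_comp _ _ c2 (d2 _)).
    exact: (cvg_pair (F := nbhs w) e1 e2).
  apply/seteqP; split=> [z /combP[p' Kp' [q' Lq' ->]]|_ [[p' q'] [/= Kp' Lq'] <-]].
    by exists (p', q').
  by apply/combP; exists p' => //; exists q'.
move=> _ _ /combP[p1 K1 [q1 L1 ->]] /combP[p2 K2 [q2 L2 ->]] t t0 t1.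
apply/combP; exists ((1 - t) * p1.1 + t * p2.1, (1 - t) * p1.2 + t * p2.2).
  exact: vK.
exists ((1 - t) * q1.1 + t * q2.1, (1 - t) * q1.2 + t * q2.2); first exact: vL.
by rewrite /pcomb /=; congr pair; ring.
Qed.

Lemma flip_comb a b K L : flip (comb a b K L) = comb a b (flip K) (flip L).
Proof.
apply/seteqP; split=> [[x y] /= /combP[[p1 p2] Kp [[q1 q2] Lq [-> /= E]]]|].
  apply/combP; exists (p1, - p2); first by rewrite /flip /= opprK.
  exists (q1, - q2); first by rewrite /flip /= opprK.
  by rewrite /pcomb /= !mulrN -opprD -E opprK.
move=> z /combP[p Kp [q Lq ->]].
apply/combP; exists (p.1, - p.2) => //; exists (q.1, - q.2) => //.
by rewrite /pcomb /= !mulrN -opprD.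
Qed.

Lemma maximizes_comb a b s K L p q : 0 < a -> 0 < b ->
  maximizes s K p -> maximizes s L q -> maximizes s (comb a b K L) (pcomb a b p q).
Proof.
move=> a0 b0 [Kp Hp] [Lq Hq]; split; first by apply/combP; exists p => //; exists q.
move=> _ /combP[p' /Hp Kp' [q' /Hq Lq' ->]] /=.
have := ler_wpM2l (ltW a0) Kp'; have := ler_wpM2l (ltW b0) Lq'; lra.
Qed.

Lemma in_boxW C C' M : C <= C' -> in_box C M -> in_box C' M.
Proof. by move=> CC bM z /bM[z1 z2]; split; apply: le_trans CC. Qed.

Lemma ex_in_box M : convex_body M -> exists2 C, 0 < C & in_box C M.
Proof.
move=> [_ [/compact_bounded[C [_ HC]] _]].
exists (`|C| + 1); first by rewrite ltr_wpDl.
move=> z Mz; have CC : C < `|C| + 1 by rewrite ltr_pwDr // ler_norm.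
by have := HC _ CC z Mz; rewrite /= prod_normE ge_max => /andP[].
Qed.

(** Each trapezoid is a quadratic form in the coordinates of its corners, hence in [a, b]; the
    coefficient of [a * b] is read off at [a = b = 1]. *)
Lemma trapezoids_comb m a b (p q : nat -> pt) :
  trapezoids m (fun k => pcomb a b (p k) (q k)) =
  a ^+ 2 * trapezoids m p + b ^+ 2 * trapezoids m q
  + a * b * (trapezoids m (fun k => pcomb 1 1 (p k) (q k))
             - trapezoids m p - trapezoids m q).
Proof.
elim: m => [|m IH]; first by rewrite /trapezoids !big_ord0; ring.
have recE (t : nat -> pt) : trapezoids m.+1 t =
  trapezoids m t + ((t m.+1).1 - (t m).1) * ((t m).2 + (t m.+1).2) / 2.
  exact: big_ord_recr.
by rewrite !recE IH /pcomb /=; field.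
Qed.

Lemma le_inv_nat_eq0 (e D : R) : (forall N, (0 < N)%N -> `|e| <= D / N%:R) -> e = 0.
Proof.
move=> H; apply/eqP; rewrite -normr_le0 leNgt; apply/negP => e0.
pose N := (Num.truncn (D / `|e|)).+1.
have := H N (ltn0Sn _); have : D / `|e| < N%:R by exact: truncnS_gt.
rewrite ltr_pdivrMr // ler_pdivlMr ?ltr0n // mulrC; lra.
Qed.

(** The same touching points of [K] and [L] serve all four bodies, so the exact identity between
    trapezoid sums passes to the areas up to a multiple of [1 / N], for every [N]. *)
Lemma top_area_quadratic C a b K L : 0 < C -> 0 < a -> 0 < b ->
  convex_body K -> convex_body L ->
  in_box C K -> in_box C L -> in_box C (comb 1 1 K L) -> in_box C (comb a b K L) ->
  top_area C (comb a b K L) =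
  a ^+ 2 * top_area C K + b ^+ 2 * top_area C L
  + a * b * (top_area C (comb 1 1 K L) - top_area C K - top_area C L).
Proof.
move=> C0 a0 b0 cK cL bK bL b1 bab; apply/eqP; rewrite -subr_eq0; apply/eqP.
(* One approximation error for each area, weighted by its coefficient; the bracket behind [a * b]
   contains three areas. *)
apply: (@le_inv_nat_eq0 _ ((1 + a ^+ 2 + b ^+ 2 + 3 * (a * b)) * (10 * C ^+ 2))).
move=> N N0.
pose p k := xget (0, 0) [set z | maximizes (slope R N k) K z].
pose q k := xget (0, 0) [set z | maximizes (slope R N k) L z].
have Hp k : maximizes (slope R N k) K (p k).
  by have [z] := ex_maximizes (slope R N k) cK; exact: xgetI.
have Hq k : maximizes (slope R N k) L (q k).
  by have [z] := ex_maximizes (slope R N k) cL; exact: xgetI.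
have := top_area_approx C0 cK bK N0 (fun k _ => Hp k).
have := top_area_approx C0 cL bL N0 (fun k _ => Hq k).
have := top_area_approx C0 (convex_body_comb 1 1 cK cL) b1 N0
  (fun k _ => maximizes_comb ltr01 ltr01 (Hp k) (Hq k)).
have := top_area_approx C0 (convex_body_comb a b cK cL) bab N0
  (fun k _ => maximizes_comb a0 b0 (Hp k) (Hq k)).
rewrite trapezoids_comb -(mulrA _ (10 * C ^+ 2)).
move: (10 * C ^+ 2 / N%:R) => E Hab H1 HL HK.
have ab0 : 0 < a * b by rewrite mulr_gt0.
have a20 : 0 <= a ^+ 2 by rewrite sqr_ge0.
have b20 : 0 <= b ^+ 2 by rewrite sqr_ge0.
have sc c u : 0 <= c -> `|u| <= E -> - (c * E) <= c * u <= c * E.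
  by move=> c0; rewrite -ler_norml normrM (ger0_norm c0) => /(ler_wpM2l c0).
have /andP[A1 A2] := sc _ _ a20 HK; have /andP[B1 B2] := sc _ _ b20 HL.
have /andP[C1 C2] := sc _ _ (ltW ab0) HK; have /andP[D1 D2] := sc _ _ (ltW ab0) HL.
have /andP[E1 E2] := sc _ _ (ltW ab0) H1.
move: Hab; rewrite !ler_norml => /andP[F1 F2]; lra.
Qed.

(** Mirroring commutes with Minkowski combinations, so the upper boundaries of the bodies and of
    their mirror images obey the same formula. All bodies are first put into one common box. *)
Lemma area_quadratic a b K L : 0 < a -> 0 < b -> convex_body K -> convex_body L ->
  area (comb a b K L) =
  a ^+ 2 * area K + b ^+ 2 * area L
  + a * b * (area (comb 1 1 K L) - area K - area L).
Proof.
move=> a0 b0 cK cL.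
have c1 := convex_body_comb 1 1 cK cL; have cab := convex_body_comb a b cK cL.
have [CK CK0 bK] := ex_in_box cK; have [CL CL0 bL] := ex_in_box cL.
have [C1 C10 b1] := ex_in_box c1; have [Cab Cab0 bab] := ex_in_box cab.
pose C := CK + CL + C1 + Cab.
have C0 : 0 < C by rewrite /C; lra.
have {}bK : in_box C K by apply: in_boxW bK; rewrite /C; lra.
have {}bL : in_box C L by apply: in_boxW bL; rewrite /C; lra.
have {}b1 : in_box C (comb 1 1 K L) by apply: in_boxW b1; rewrite /C; lra.
have {}bab : in_box C (comb a b K L) by apply: in_boxW bab; rewrite /C; lra.
rewrite !(area_top (ltW C0)) // !flip_comb.
rewrite (top_area_quadratic C0 a0 b0 cK cL) //.
rewrite (top_area_quadratic C0 a0 b0 (convex_body_flip cK) (convex_body_flip cL));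
  rewrite -?flip_comb; try exact: in_box_flip.
by ring.
Qed.

(** * Dilates and homogeneity of the mixed area *)

Lemma comb_diag a b K : 0 < a -> 0 < b -> convex_body K ->
  comb a b K K = mscale (a + b) K.
Proof.
move=> a0 b0 [_ [_ vK]]; have ab : a + b != 0 by rewrite gt_eqF // addr_gt0.
apply/seteqP; split=> [z /combP[p Kp [q Kq ->]]|_ [p Kp ->]].
  pose t := b / (a + b).
  have t0 : 0 <= t by rewrite divr_ge0 //; lra.
  have t1 : t <= 1 by rewrite ler_pdivrMr; lra.
  exists ((1 - t) * p.1 + t * q.1, (1 - t) * p.2 + t * q.2); first exact: vK.
  by rewrite /pcomb /t /=; congr pair; field.
by apply/combP; exists p => //; exists p => //; rewrite /pcomb; congr pair; ring.
Qed.

(** Written as a positive combination, a dilate falls under both the quadratic area formula and the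
    closure property of the given family. *)
Lemma mscale_comb a K : 0 < a -> convex_body K -> mscale a K = comb (a / 2) (a / 2) K K.
Proof.
move=> a0 cK; have a20 : 0 < a / 2 by rewrite divr_gt0.
by rewrite comb_diag //; congr mscale; field.
Qed.

Lemma area_mscale a K : 0 < a -> convex_body K -> area (mscale a K) = a ^+ 2 * area K.
Proof.
move=> a0 cK.
(* With both coefficients [c / 2] the terms in [area K] cancel; comparing with [c = 1] then
   eliminates the area of [comb 1 1 K K]. *)
have E c : 0 < c -> area (mscale c K) = c ^+ 2 / 4 * area (comb 1 1 K K).
  move=> c0; rewrite mscale_comb // area_quadratic ?divr_gt0 //.
  by field.
by rewrite E // -[in RHS](mscale1 K) (E 1 ltr01); field.
Qed.

Lemma mixed_area_mscale a b K L : 0 < a -> 0 < b -> convex_body K -> convex_body L ->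
  mixed_area (mscale a K) (mscale b L) = a * b * mixed_area K L.
Proof.
move=> a0 b0 cK cL; rewrite /mixed_area !area_mscale // msum_comb.
rewrite -/(comb a b K L) /comb !mscale1 -/(comb a b K L) area_quadratic // -msum_comb.
by field.
Qed.

Lemma mixed_areaC K L : mixed_area K L = mixed_area L K.
Proof.
rewrite /mixed_area (_ : msum K L = msum L K); last first.
  by apply/seteqP; split=> z [p Hp [q Hq ->]]; exists q => //; exists p => //;
    congr pair; rewrite addrC.
by congr (_ / _); ring.
Qed.

(** * Monotonicity of area and nonnegativity of the mixed area *)

Lemma area_ge0 K : 0 <= area K.
Proof. by apply: fine_ge0; apply: integral_ge0. Qed.

Lemma area_set1 (v : pt) : area [set v] = 0.
Proof.
rewrite /area (_ : [set v] = [set v.1] `*` [set v.2]).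
  by rewrite product_measure1E //= lebesgue_measure_set1 mul0e.
by case: v => x y; apply/seteqP; split=> [_ ->|[x' y'] [/= -> ->]].
Qed.

Lemma convex_body_set1 (v : pt) : convex_body [set v].
Proof.
split; first by exists v.
split; first exact: compact_set1.
move=> _ _ -> -> t _ _; case: v => x y /=; congr pair; ring.
Qed.

Lemma area_le K L : convex_body K -> convex_body L -> K `<=` L -> area K <= area L.
Proof.
move=> cK cL KL; have [C C0 bL] := ex_in_box cL.
have bK : in_box C K by move=> z /KL /bL.
have it M : convex_body M -> in_box C M ->
    (@lebesgue_measure R).-integrable `[- C, C] (EFin \o top M).
  move=> cM bM; exact: (bounded_integrable_itv (measurable_top cM bM)
    (fun x => top_bound x (ltW C0) bM)).
have cK' := convex_body_flip cK; have bK' := in_box_flip bK.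
have cL' := convex_body_flip cL; have bL' := in_box_flip bL.
have iD M : convex_body M -> in_box C M -> (@lebesgue_measure R).-integrable
    `[- C, C] (EFin \o (fun x => top M x + top (flip M) x)).
  move=> cM bM; rewrite (_ : _ \o _ = (EFin \o top M) \+ (EFin \o top (flip M))) //.
  by apply: integrableD => //; apply: it => //;
    [exact: convex_body_flip | exact: in_box_flip].
rewrite !(area_top (ltW C0)) // /top_area -!RintegralD //; do ?exact: it.
apply: le_Rintegral => //; do ?exact: iD.
move=> x _; have [[y Kxy]|nK] := pselect (exists y, K (x, y)).
  have Kxy' : flip K (x, - y) by rewrite /flip /= opprK.
  apply: lerD; first exact: (top_ub bL (KL _ (top_mem cK bK Kxy))).
  exact: (top_ub bL' (KL _ (top_mem cK' bK' Kxy'))).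
(* Where the slice of [K] is empty, a single boundary value of [L] may be negative, but the sum of
   both is the length of the slice of [L]. *)
rewrite (@top_out _ K) => [|y Kxy]; last by apply: nK; exists y.
rewrite (@top_out _ (flip K)) => [|y Kxy]; last by apply: nK; exists (- y).
by rewrite addr0 -lee_fin -(slice_measure x cL bL).
Qed.

(* The area of [K + t v] is affine and nonnegative in [t > 0]. *)
Lemma area_translate_ge K (v : pt) : convex_body K -> area K <= area (msum K [set v]).
Proof.
move=> cK; have cv := convex_body_set1 v; rewrite msum_comb leNgt; apply/negP => lt.
pose d := area K - area (comb 1 1 K [set v]).
have d0 : 0 < d by rewrite subr_gt0.
(* This [t] makes the affine expression [area K - t * d] equal to [-1]. *)
pose t := (area K + 1) / d.
have t0 : 0 < t by rewrite divr_gt0 // ltr_wpDl // area_ge0.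
have := area_ge0 (comb 1 t K [set v]); rewrite area_quadratic // area_set1.
have : t * d = area K + 1 by rewrite divfK // gt_eqF.
by rewrite /d; lra.
Qed.

(** For [v] in [L], the body [K + t L] contains [K + t v], so its area is at least that of [K].
    Expanding, dividing by [t] and taking [t] small leaves the mixed area. *)
Lemma mixed_area_ge0 K L : convex_body K -> convex_body L -> 0 <= mixed_area K L.
Proof.
move=> cK cL; have [[v Lv] _] := cL.
have ge t : 0 < t -> 0 <= 2 * mixed_area K L + t * area L.
  move=> t0; have : area K <= area (comb 1 t K L).
    have := @area_translate_ge K (t * v.1, t * v.2) cK; move/le_trans; apply.
    apply: area_le; [rewrite msum_comb; apply: convex_body_comb => //;
      exact: convex_body_set1 | exact: convex_body_comb |].
    move=> z [p Kp [_ -> ->]]; apply/combP; exists p => //; exists v => //.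
    by rewrite /pcomb !mul1r.
  rewrite area_quadratic // -msum_comb => H.
  rewrite -(pmulr_rge0 _ t0) /mixed_area; lra.
rewrite leNgt; apply/negP => V0; have A0 := area_ge0 L.
pose t := - mixed_area K L / (area L + 1).
have t0 : 0 < t by rewrite divr_gt0 //; lra.
have tE : t * (area L + 1) = - mixed_area K L by rewrite divfK // gt_eqF //; lra.
by have := ge t t0; lra.
Qed.

End MinkowskiCombination.

(** * Perfect matchings of finite sets *)

Section Pairings.
Local Open Scope nat_scope.
Variable T : finType.
Implicit Types (A : {set T}) (P : {set {set T}}).

(** The notion [pairing] relative to a subset [A], so that matchings can be built by adding one pair
    at a time. *)
Definition pairs_up P A : bool :=
  finset.partition P A && [forall I in P, #|I| == 2].

Lemma pairs_up_add P A i j : pairs_up P A -> i \notin A -> j \notin A ->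
  i != j -> pairs_up ([set i; j]%SET |: P)%SET (i |: (j |: A))%SET.
Proof.
move=> /andP[/and3P[/eqP cP tP P0] /forall_inP P2] iA jA ij.
have cardij : #|[set i; j]%SET| == 2 by rewrite cards2 ij.
apply/andP; split; last first.
  by apply/forall_inP => I /setU1P[->//|/P2].
have dis B : B \in P -> fintype.disjoint (mem [set i; j]%SET) (mem B).
  move=> BP; rewrite -finset.setI_eq0; apply/eqP/setP => z; rewrite !inE.
  apply/negbTE/negP => /andP[zij zB].
  have zA : z \in A by rewrite -cP; apply/bigcupP; exists B.
  by move: zij => /orP[]/eqP zE; move: iA jA; rewrite -zE zA.
apply/and3P; split.
- by rewrite /finset.cover finset.bigcup_setU big_set1 -/(finset.cover P) cP finset.setUA.
- apply/finset.trivIsetP => B1 B2 /setU1P[->|B1P] /setU1P[->|B2P] //.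
  + by rewrite eqxx.
  + by move=> _; exact: dis.
  + by move=> _; rewrite disjoint_sym; exact: dis.
  + by move/finset.trivIsetP: tP; apply.
- rewrite !inE negb_or P0 andbT; apply/eqP => E.
  by move: cardij; rewrite -E cards0.
Qed.

Lemma ex_pairs_up A : ~~ odd #|A| -> exists P, pairs_up P A.
Proof.
move: {2}#|A| (leqnn #|A|) => m; elim: m A => [|m IH] A.
  rewrite leqn0 cards_eq0 => /eqP -> _; exists finset.set0.
  apply/andP; split; last by apply/forall_inP => I; rewrite inE.
  by apply/and3P; rewrite /finset.cover big_set0 inE; split=> //;
    apply/finset.trivIsetP => ? ?; rewrite inE.
move=> Am oA; have [A0|[i iA]] := finset.set_0Vmem A.
  by apply: IH oA; rewrite A0 cards0.
have cA := cardsD1 i A; rewrite iA in cA.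
have [A0|[j jA]] := finset.set_0Vmem (A :\ i)%SET.
  by move: oA; rewrite cA A0 cards0.
have cAi := cardsD1 j (A :\ i)%SET; rewrite jA in cAi.
have cA2 : #|A| = #|(A :\ i :\ j)%SET|.+2 by rewrite cA cAi.
have [||P PP] := IH (A :\ i :\ j)%SET.
- by apply/ltnW; rewrite -ltnS -cA2.
- by move: oA; rewrite cA2 /= negbK.
have /setD1P[ji _] := jA.
exists ([set i; j]%SET |: P)%SET.
rewrite -(finset.setD1K iA) -(finset.setD1K jA).
by apply: pairs_up_add; rewrite ?inE ?eqxx ?andbF // eq_sym.
Qed.

End Pairings.

(** * Ratios of vectors with equal partition monomials *)

Section PairRatios.
Variables (R : realType) (n : nat).
Implicit Types x y : {set 'I_n} -> R.
Local Notation pair i j := [set i; j]%SET.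

Lemma big_pairs_up_add (A : {set 'I_n}) P (i j : 'I_n) x :
  pairs_up P A -> i \notin A ->
  \prod_(I in (pair i j |: P)%SET) x I = x (pair i j) * \prod_(I in P) x I.
Proof.
move=> /andP[/and3P[/eqP cP _ _] _] iA; rewrite big_setU1 //.
apply/negP => ijP; move/negP: iA; apply; rewrite -cP; apply/bigcupP.
by exists (pair i j) => //; rewrite !inE eqxx.
Qed.

Hypothesis n_even : ~~ odd n.

(** Any pair extends to a perfect matching; its monomial is positive at [x], hence has no zero
    factor at [y]. *)
Lemma phi_eq_neq0 x y : (forall I, two_subset I -> 0 < x I) ->
  phivec_eq (phi x) (phi y) -> forall i j, i != j -> y (pair i j) != 0.
Proof.
move=> x0 xy i j ij.
pose A := (~: pair i j)%SET.
have cA : ~~ odd #|A|.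
  have := cardsC (pair i j); rewrite cards2 ij card_ord => nE.
  by have := n_even; rewrite -[X in odd X]nE /= negbK.
have [P PP] := ex_pairs_up cA.
have iA : i \notin A by rewrite !inE eqxx.
have jA : j \notin A by rewrite !inE eqxx orbT.
have PT : pairing (pair i j |: P)%SET.
  rewrite /pairing.
  rewrite (_ : [set: 'I_n]%SET = (i |: (j |: A))%SET).
    exact: pairs_up_add.
  by apply/setP => z; rewrite !inE; case: eqP => //=; case: eqP.
have := xy _ PT; rewrite /phi => E; apply/eqP => y0.
have : 0 < \prod_(I in (pair i j |: P)%SET) x I.
  by apply: prodr_gt0 => I IP; apply: x0; case/andP: PT => _ /forall_inP; apply.
by rewrite E (big_pairs_up_add _ _ PP iA) y0 mul0r ltxx.
Qed.

(** Let [P] match the remaining indices. Completing [P] by [ij, kl] or by [ik, jl] gives two perfect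
    matchings, and both products of ratios equal the quotient of the [P]-monomials of [y] and
    [x]. *)
Lemma phi_eq_swap x y : (forall I, two_subset I -> 0 < x I) ->
  (forall I, two_subset I -> 0 < y I) ->
  phivec_eq (phi x) (phi y) ->
  let r i j := x (pair i j) / y (pair i j) in
  forall i j k l, uniq [:: i; j; k; l] -> r i j * r k l = r i k * r j l.
Proof.
move=> x0 y0 xy r i j k l; rewrite /= !inE !negb_or.
move=> /and4P[/and3P[ij ik il] /andP[jk jl] kl _].
pose A := (~: (i |: (j |: pair k l)))%SET.
have cA : ~~ odd #|A|.
  have := cardsC (i |: (j |: pair k l))%SET.
  rewrite (cardsU1 i) (cardsU1 j) cards2 kl !inE !negb_or jk jl ij ik il card_ord => nE.
  by have := n_even; rewrite -[X in odd X]nE /= !negbK.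
have [P PP] := ex_pairs_up cA.
(* Stated for any ordering of the four indices, to serve both matchings. *)
have prodE (z : {set 'I_n} -> R) a b c d :
    uniq [:: a; b; c; d] -> [set:: [:: a; b; c; d]] = (i |: (j |: pair k l))%SET ->
    \prod_(I in (pair a b |: (pair c d |: P))%SET) z I =
     z (pair a b) * (z (pair c d) * \prod_(I in P) z I) /\
    pairing (pair a b |: (pair c d |: P))%SET.
  rewrite /= !inE !negb_or => /and4P[/and3P[ab ac ad] /andP[bc bd] cd _] E.
  have memA t : t \in [:: a; b; c; d] -> t \notin A.
    by move=> tm; rewrite /A -E !inE negbK; move: tm; rewrite !inE.
  have PP1 : pairs_up (pair c d |: P)%SET (c |: (d |: A))%SET.
    by apply: pairs_up_add => //; apply: memA; rewrite !inE eqxx ?orbT.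
  have aA : a \notin (c |: (d |: A))%SET.
    rewrite !in_setU1 !negb_or ac ad memA // !inE eqxx ?orbT //.
  have bA : b \notin (c |: (d |: A))%SET.
    rewrite !in_setU1 !negb_or bc bd memA // !inE eqxx ?orbT //.
  rewrite (big_pairs_up_add _ _ PP1 aA) (big_pairs_up_add _ _ PP) //; last first.
    by apply: memA; rewrite !inE eqxx ?orbT.
  split=> //; rewrite /pairing.
  rewrite (_ : [set: 'I_n]%SET = (a |: (b |: (c |: (d |: A))))%SET).
    exact: pairs_up_add.
  apply/setP => z'; rewrite /A -E !inE.
  by do 4 case: eqP => //=.
have E1 : [set:: [:: i; j; k; l]] = (i |: (j |: pair k l))%SET.
  by apply/setP => z; rewrite !inE.
have E2 : [set:: [:: i; k; j; l]] = (i |: (j |: pair k l))%SET.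
  by apply/setP => z; rewrite !inE; do 4 case: (z == _).
have u1 : uniq [:: i; j; k; l] by rewrite /= !inE !negb_or ij ik il jk jl kl.
have u2 : uniq [:: i; k; j; l].
  by rewrite /= !inE !negb_or ij ik il (eq_sym k) jk jl kl.
have [X1 P1] := prodE x _ _ _ _ u1 E1; have [Y1 _] := prodE y _ _ _ _ u1 E1.
have [X2 P2] := prodE x _ _ _ _ u2 E2; have [Y2 _] := prodE y _ _ _ _ u2 E2.
have := xy _ P1; have := xy _ P2; rewrite /phi X1 X2 Y1 Y2.
have p0 (z : {set 'I_n} -> R) : (forall I, two_subset I -> 0 < z I) ->
    0 < \prod_(I in P) z I.
  move=> z0; apply: prodr_gt0 => I IP; apply: z0.
  by case/andP: PP => _ /forall_inP; apply.
have {}p2 (z : {set 'I_n} -> R) a b : (forall I, two_subset I -> 0 < z I) ->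
    a != b -> z (pair a b) != 0.
  by move=> z0 ab; rewrite gt_eqF // z0 // /two_subset cards2 ab.
have := lt0r_neq0 (p0 _ x0); have := lt0r_neq0 (p0 _ y0).
move: (\prod_(I in P) x I) (\prod_(I in P) y I) => px py py0 px0 e2 e1.
have Q1 : r i j * r k l = py / px.
  apply: (@mulIf _ px) => //; rewrite divfK // /r.
  apply: (@mulIf _ (y (pair i j) * y (pair k l))).
    by rewrite mulf_neq0 ?p2.
  transitivity (x (pair i j) * (x (pair k l) * px)).
    by field; rewrite !p2.
  by rewrite e1; ring.
have Q2 : r i k * r j l = py / px.
  apply: (@mulIf _ px) => //; rewrite divfK // /r.
  apply: (@mulIf _ (y (pair i k) * y (pair j l))).
    by rewrite mulf_neq0 ?p2.
  transitivity (x (pair i k) * (x (pair j l) * px)).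
    by field; rewrite !p2.
  by rewrite e2; ring.
by rewrite Q1 Q2.
Qed.

End PairRatios.

(** * Swap-invariant symmetric arrays have rank one off the diagonal *)

Section RankOne.
Variables (R : realType) (n : nat) (r : 'I_n -> 'I_n -> R).
Hypotheses (n_even : ~~ odd n) (r_sym : forall i j, r i j = r j i).
Hypothesis r_gt0 : forall i j, i != j -> 0 < r i j.
Hypothesis r_swap : forall i j k l, uniq [:: i; j; k; l] ->
  r i j * r k l = r i k * r j l.

Lemma swap_invariant_rank1 : exists2 a : 'I_n -> R, (forall i, 0 < a i) &
  forall i j, i != j -> r i j = a i * a j.
Proof.
have [n0|n_gt0] := posnP n.
  by exists (fun=> 1) => // i; have := ltn_ord i; rewrite [X in (_ < X)%N]n0.
pose o := Ordinal n_gt0.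
(* If [r i j = a i * a j], then [r o i * r o j / r i j] is the square of [a o]; the task is to show
   that this quotient is the same for all [i, j]. *)
have [c c0 rc] : exists2 c, 0 < c & forall i j, i != j -> i != o -> j != o ->
    r o i * r o j = c * r i j.
  have [n_small|n_big] := leqP n 3.
    (* Parity leaves only [n = 2] here, with no two distinct indices besides [o], so any positive
       [c] would do. *)
    exists 1 => // i j ij io jo; exfalso.
    have : (#|[set o; i; j]%SET| <= n)%N by rewrite -[leqRHS]card_ord max_card.
    rewrite -finset.setUA cardsU1 cards2 ij !inE negb_or (eq_sym o) io eq_sym jo.
    by move: n_even n_small; case: (n) => [|[|[|[|]]]].
  have lt1 : (1 < n)%N by apply: leq_trans n_big.
  have lt2 : (2 < n)%N by apply: leq_trans n_big.
  pose p := Ordinal lt1; pose q := Ordinal lt2.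
  have op : o != p by []. have oq : o != q by []. have pq : p != q by [].
  have rn i j : i != j -> r i j != 0 by move=> /r_gt0 /lt0r_neq0.
  exists (r o p * r o q / r p q).
    by rewrite divr_gt0 ?mulr_gt0 ?r_gt0.
  (* [step] keeps the quotient when the pair [p, q] becomes [p, j]; [step'] does so when [p, j]
     becomes [i, j]. *)
  have step j : j != o -> j != p -> j != q -> r o j * r p q = r o q * r p j.
    move=> jo jp jq; rewrite (r_sym p q) (r_sym p j) (@r_swap o j q p).
      by rewrite (r_sym j).
    by rewrite /= !inE !negb_or (eq_sym o j) jo ?oq ?op jq jp.
  have step' i j : uniq [:: o; i; p; j] -> r o i * r p j = r o p * r i j.
    exact: r_swap.
  suff main i j : i != j -> i != o -> j != o ->
      r o i * r o j * r p q = r o p * r o q * r i j.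
    move=> i j ij io jo; apply: (@mulIf _ (r p q)); first exact: rn.
    by rewrite main //; field; exact: rn.
  (* By symmetry, [p] can occur only as [i] and [q] only as [j], which matches the order of the two
     replacements. *)
  wlog : i j / i != q /\ (i == p \/ j != p).
    move=> W ij io jo.
    have [iq|iq] := eqVneq i q.
      have jq : j != q by rewrite -iq eq_sym.
      rewrite (mulrC (r o i)) (r_sym i j); apply: (W j i _ _ jo io).
        by split=> //; right; rewrite iq.
      by rewrite eq_sym.
    have [ip|ip] := eqVneq i p; first by apply: W => //; split=> //; left; apply/eqP.
    have [jp|jp] := eqVneq j p.
      rewrite (mulrC (r o i)) (r_sym i j); apply: (W j i _ _ jo io).
        by rewrite jp; split=> //; left.
      by rewrite eq_sym.
    by apply: W => //; split=> //; right.
  move=> [iq ipj] ij io jo.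
  have [ip|ip] := eqVneq i p.
    subst i; have [->|jq] := eqVneq j q; first by ring.
    have jp : j != p by rewrite eq_sym.
    by rewrite -mulrA step //; ring.
  have jp : j != p by case: ipj => // /eqP; move: ip => /eqP.
  have [->|jq] := eqVneq j q.
    have -> : r o i * r o q * r p q = r o q * (r o i * r p q) by ring.
    rewrite step'; first by ring.
    by rewrite /= !inE !negb_or (eq_sym o i) io ?op ?oq ip iq ?pq.
  rewrite -mulrA step // [LHS](_ : _ = r o q * (r o i * r p j)); last by ring.
  rewrite step'; first by ring.
  by rewrite /= !inE !negb_or (eq_sym o i) (eq_sym o j) (eq_sym p j) io ?op jo ip ij jp.
have sc : 0 < Num.sqrt c by rewrite sqrtr_gt0.
have sE : Num.sqrt c * Num.sqrt c = c by rewrite -expr2 sqr_sqrtr // ltW.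
exists (fun i => if i == o then Num.sqrt c else r o i / Num.sqrt c).
  move=> i; case: eqP => // /eqP io; rewrite divr_gt0 // r_gt0 // eq_sym //.
move=> i j ij; have sn := lt0r_neq0 sc.
have [io|io] := eqVneq i o.
  by subst i; rewrite eq_sym (negbTE ij) mulrC divfK.
have [jo|jo] := eqVneq j o; first by subst j; rewrite divfK.
apply: (@mulfI _ c); first exact: lt0r_neq0.
rewrite -rc //; move: sE sn; move: (Num.sqrt c) => s <- sn.
by field.
Qed.
End RankOne.

(** * Recovering a configuration by dilating the bodies *)

Lemma pvcoord_pair (R : realType) n (K : 'I_n -> set (R * R)) (i j : 'I_n) :
  i != j -> pvcoord K [set i; j]%SET = mixed_area (K i) (K j).
Proof.
(* Either element may be picked first; symmetry of the mixed area makes the result independent of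
   the choice. *)
move=> ij; rewrite /pvcoord; case: pickP => [k|/(_ i)]; last by rewrite !inE eqxx.
rewrite !inE => /orP[]/eqP ->.
  case: pickP => [l|/(_ j)]; last by rewrite !inE eq_sym ij eqxx orbT.
  by rewrite !inE => /andP[/negbTE -> /= /eqP ->].
case: pickP => [l|/(_ i)]; last by rewrite !inE ij eqxx.
by rewrite !inE => /andP[/negbTE -> ]; rewrite orbF => /eqP ->; rewrite mixed_areaC.
Qed.

Theorem theorem3p1 (R : realType) (n : nat) (A : set (set (R * R)%type)) :
  (2 <= n)%N -> ~~ odd n ->
  (forall K, A K -> convex_body K) ->
  pos_comb_closed A ->
  forall x : {set 'I_n} -> R,
    (forall I, two_subset I -> 0 < x I) ->
    (@PV R n A x <->
     exists2 y, @PV R n A y & phivec_eq (phi x) (phi y)).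
Proof.
move=> _ n_even bodyA closedA x x0; split=> [PVx|[y [K [AK yK]] xy]].
  by exists x.
have pairP (I : {set 'I_n}) : two_subset I ->
    exists i j, i != j /\ I = [set i; j]%SET.
  by move=> /cards2P.
have two i j : i != j -> two_subset [set i; j]%SET.
  by move=> ij; rewrite /two_subset cards2 ij.
(* Positivity is assumed for [x] only; the entries of [y] are mixed areas, hence nonnegative, and
   nonzero by comparison of monomials. *)
have y0 I : two_subset I -> 0 < y I.
  move=> /pairP[i [j [ij ->]]]; rewrite lt_neqAle eq_sym.
  rewrite (phi_eq_neq0 n_even x0 xy ij) yK ?two // pvcoord_pair //.
  by apply: mixed_area_ge0; exact: bodyA.
pose r i j := x [set i; j]%SET / y [set i; j]%SET.
have r_sym i j : r i j = r j i by rewrite /r finset.setUC.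
have r_gt0 i j : i != j -> 0 < r i j.
  by move=> ij; rewrite divr_gt0 ?x0 ?y0 ?two.
have [a a0 ra] := swap_invariant_rank1 n_even r_sym r_gt0 (phi_eq_swap n_even x0 y0 xy).
(* Dilating by [a i] multiplies the entry at [i, j] by [a i * a j], the ratio of [x] to [y]
   there. *)
exists (fun i => mscale (a i) (K i)); split=> [i|_ /pairP[i [j [ij ->]]]].
  rewrite mscale_comb //; last exact: bodyA.
  by apply: closedA; rewrite ?divr_gt0.
rewrite pvcoord_pair // mixed_area_mscale //; do ?exact: bodyA.
by rewrite -ra // -(pvcoord_pair K) // -yK ?two // divfK // gt_eqF // y0 ?two.
Qed.
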